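(* Let $X$ be a $k$-dimensional polytope in $\mathbb{R}^k$, and let $y \in \mathbb{R}^k$ be a point outside $X$ that does not lie in the affine hull of any facet of $X$. Then there exists an acyclic matching on the poset of faces of $X$ visible from $y$ such that no face is critical.
   Context: A polytope is a bounded intersection of finitely many closed halfspaces. Its faces include the polytope $X$ itself (trivial face); the empty set is not counted as a visible face. Facets are faces of codimension $1$. A facet $G$ of $X$ is visible from $y$ if every line segment from $y$ to a point of $G$ does not intersect the interior of $X$. A face $F$ of $X$ is visible from $y$ if all the facets $G\supseteq F$ of $X$ are visible from $y$; in particular $X$ itself is always visible. The set of visible faces is ordered by inclusion. For a ranked poset $P$, let $\mathcal{E}=\{(p,q)\mid q\lessdot p\}$ be the set of edges of its Hasse diagram. A matching is a subset $\mathcal{M}\subseteq\mathcal{E}$ such that every element of $P$ appears in at most one edge of $\mathcal{M}$; it is acyclic if the directed graph obtained by orienting $(p,q)\in\mathcal{E}$ from $p$ to $q$ when $(p,q)\notin\mathcal{M}$ and from $q$ to $p$ when $(p,q)\in\mathcal{M}$ has no directed cycle. Elements not appearing in any edge of $\mathcal{M}$ are critical. *)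

(* Defs.v *)
From mathcomp Require Import all_boot all_order all_algebra.
From mathcomp Require Import all_classical all_reals all_analysis.

Set Implicit Arguments.
Unset Strict Implicit.
Unset Printing Implicit Defensive.

Import Order.TTheory GRing.Theory Num.Theory.
Import numFieldNormedType.Exports.

Local Open Scope classical_set_scope.
Local Open Scope ring_scope.

Section Matchings.
Context (d : Order.disp_t) (T : porderType d).
(* A poset is given as a subset P of an ordered type, with the induced order. *)
Implicit Types (P : set T) (M : set (T * T)).

Definition covered_in P (q p : T) : Prop :=
  [/\ P q, P p, (q < p)%O & forall r, P r -> ~ ((q < r)%O /\ (r < p)%O)].

Definition hasse_edges P : set (T * T) := [set e | covered_in P e.2 e.1].

Definition endpoint (p : T) (e : T * T) : Prop := p = e.1 \/ p = e.2.

Definition is_matching P M : Prop :=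
  M `<=` hasse_edges P /\
  forall p e1 e2, P p -> M e1 -> M e2 ->
    endpoint p e1 -> endpoint p e2 -> e1 = e2.

Definition matching_arc P M (p q : T) : Prop :=
  (hasse_edges P (p, q) /\ ~ M (p, q)) \/
  (hasse_edges P (q, p) /\ M (q, p)).

(* [cycle e [::]] holds by convention, hence the nonemptiness condition. *)
Definition acyclic P M : Prop :=
  ~ exists s : seq T,
      s <> [::] /\ cycle (fun p q => `[< matching_arc P M p q >]) s.

Definition critical P M : set T :=
  [set p | P p /\ ~ exists e, M e /\ endpoint p e].

End Matchings.

Section Polytopes.
Context (R : realType) (k : nat).
Local Notation V := 'rV[R]_k.
Implicit Types (X F G A : set V) (x y z : V).

Definition dotv (u v : V) : R := \sum_i u 0 i * v 0 i.

Definition halfspace (a : V) (b : R) : set V := [set x | dotv a x <= b].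

Definition polytope X : Prop :=
  bounded_set X /\
  exists (m : nat) (a : 'I_m -> V) (b : 'I_m -> R),
    (forall i, a i != 0) /\
    X = \bigcap_(i in [set: 'I_m]) halfspace (a i) (b i).

Definition affine_hull A : set V :=
  [set x | exists (n : nat) (p : 'I_n -> V) (c : 'I_n -> R),
    [/\ forall i, A (p i), \sum_i c i = 1 & x = \sum_i c i *: p i]].

(* The empty set has no dimension in this sense. *)
Definition has_dim A (n : nat) : Prop :=
  exists (x : V) (U : {vspace V}),
    affine_hull A = [set x + u | u in [set` U]] /\ \dim U = n.

(* The linear form c is allowed to be 0, so that X itself (b = 0) and the
   empty set (b > 0) are faces of X. *)
Definition face X F : Prop :=
  exists (c : V) (b : R),
    X `<=` halfspace c b /\ F = X `&` [set x | dotv c x = b].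

Definition facet X G : Prop :=
  face X G /\ exists n, has_dim G n /\ has_dim X n.+1.

Definition segment y z : set V := [set (1 - t) *: y + t *: z | t in `[0, 1]].

Definition visible_facet X y G : Prop :=
  facet X G /\ forall z, G z -> segment y z `&` X° = set0.

Definition visible_faces X y : set (set V) :=
  [set F | [/\ face X F, F !=set0 &
               forall G, facet X G -> F `<=` G -> visible_facet X y G]].

End Polytopes.

(* Main.v *)
(* Write X = {g_i <= 0} irredundantly. A face is determined by its set T of active
   inequalities, and it is visible from y iff g_i(y) > 0 for all i in T. The
   matching is built by a shelling argument, for all faces S at once. Let p lie in
   the affine span of the face S and violate some inequality; move p towards a
   generic point of the relative interior of S until it first crosses a hyperplane,
   at q. With S' the active set at q, the faces of S visible from p split into
   those visible from q and the faces of S' visible from q. If q still violates an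
   inequality, both parts have perfect acyclic matchings by induction on the number
   of violated inequalities, and their union is acyclic because no face in the first
   part is contained in one of the second. Otherwise the parts are {S} and {S'}, and
   S is matched with S'. *)
Require Import Defs.
From HB Require Import structures.
From mathcomp Require Import all_boot all_order all_algebra.
From mathcomp Require Import all_classical all_reals all_analysis.
From mathcomp Require Import ring lra.

Set Implicit Arguments.
Unset Strict Implicit.
Unset Printing Implicit Defensive.

Import Order.TTheory GRing.Theory Num.Theory.
Import numFieldNormedType.Exports.

Local Open Scope classical_set_scope.
Local Open Scope ring_scope.

(** * Acyclic matchings without critical elements *)

Definition perfect_acyclic (d : Order.disp_t) (T : porderType d)
    (P : set T) (M : set (T * T)) : Prop :=
  [/\ is_matching P M, acyclic P M & critical P M = set0].

Section PerfectMatchings.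
Context (d : Order.disp_t) (T : porderType d).
Implicit Types (P A B : set T) (M : set (T * T)).

Lemma cycle_invariant (e : rel T) (Q : T -> Prop) (s : seq T) :
  (forall p q, e p q -> Q p -> Q q) -> cycle e s ->
  (exists2 p, p \in s & Q p) -> forall p, p \in s -> Q p.
Proof.
move=> eQ es [p ps Qp]; have [i s' rs] := rot_to ps.
have : path e p s'.
  by move: es; rewrite -(rot_cycle i) rs /= rcons_path => /andP[].
move=> pth x; rewrite -(mem_rot i) rs inE => /orP[/eqP->//|].
elim: s' p Qp pth {rs ps} x => //= a s' IH p Qp /andP[/eQ/(_ Qp) Qa pth] x.
by rewrite inE => /orP[/eqP->//|]; apply: IH pth x.
Qed.

Lemma cycle_arc (e : rel T) (s : seq T) p :
  cycle e s -> p \in s -> exists2 q, q \in s & e p q.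
Proof. by move=> es ps; exists (next s p); [rewrite mem_next|exact: next_cycle]. Qed.

(** Nothing in [B] lies below an element of [A]. So the two sets are disjoint, covering relations
    within either one survive in the union, and no arc leads from [A] to [B]. A directed cycle that
    meets [A] thus stays in [A], and any other lies in [B]. *)
Lemma perfect_acyclicU A B MA MB :
  (forall a b, A a -> B b -> ~ (b <= a)%O) ->
  perfect_acyclic A MA -> perfect_acyclic B MB ->
  perfect_acyclic (A `|` B) (MA `|` MB).
Proof.
move=> AB [[hA uA] acA cA] [[hB uB] acB cB].
have disj x : A x -> B x -> False by move=> Ax Bx; apply: AB Ax Bx _.
have eA e x : MA e -> endpoint x e -> A x.
  by move=> /hA[/= ? ? _ _] [->|->].
have eB e x : MB e -> endpoint x e -> B x.
  by move=> /hB[/= ? ? _ _] [->|->].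
have hAU : hasse_edges A `<=` hasse_edges (A `|` B).
  move=> [p q] [/= Aq Ap qp nr]; split=> /=; [by left|by left|by []|].
  move=> r [Ar|Br] [qr rp]; first exact: (nr r).
  exact: (AB p r Ap Br (ltW rp)).
have hBU : hasse_edges B `<=` hasse_edges (A `|` B).
  move=> [p q] [/= Bq Bp qp nr]; split=> /=; [by right|by right|by []|].
  move=> r [Ar|Br] [qr rp]; last exact: (nr r).
  exact: (AB r q Ar Bq (ltW qr)).
have hU_A p q : A p -> A q -> hasse_edges (A `|` B) (p, q) -> hasse_edges A (p, q).
  by move=> Ap Aq [/= _ _ qp nr]; split=> //= r Ar; apply: nr; left.
have hU_B p q : B p -> B q -> hasse_edges (A `|` B) (p, q) -> hasse_edges B (p, q).
  by move=> Bp Bq [/= _ _ qp nr]; split=> //= r Br; apply: nr; right.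
have mU_A p q : A p -> (MA `|` MB) (p, q) -> MA (p, q).
  by move=> Ap [//|m]; case: (disj p Ap); apply: eB m _; left.
have mU_B p q : B p -> (MA `|` MB) (p, q) -> MB (p, q).
  by move=> Bp [m|//]; case: (disj p _ Bp); apply: eA m _; left.
pose arc := matching_arc (A `|` B) (MA `|` MB).
have arcA p q : arc p q -> A p -> A q.
  move=> [[[/= [//|Bq] _ qp _] _]|[_ [m|m]]] Ap.
  - by case: (AB p q Ap Bq (ltW qp)).
  - by apply: eA m _; left.
  - by case: (disj p Ap); apply: eB m _; right.
have arcAA p q : A p -> A q -> arc p q -> matching_arc A MA p q.
  move=> Ap Aq [[h n]|[h m]]; [left|right]; split.
  - exact: hU_A.
  - by move=> m; apply: n; left.
  - exact: hU_A.
  - exact: mU_A.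
have arcBB p q : B p -> B q -> arc p q -> matching_arc B MB p q.
  move=> Bp Bq [[h n]|[h m]]; [left|right]; split.
  - exact: hU_B.
  - by move=> m; apply: n; right.
  - exact: hU_B.
  - exact: mU_B.
split.
- split; first by move=> e [/hA/hAU|/hB/hBU].
  move=> p e1 e2 _ [m1|m1] [m2|m2] p1 p2.
  + by apply: (uA p) => //; apply: eA p1.
  + by case: (disj p); [apply: eA p1|apply: eB p2].
  + by case: (disj p); [apply: eA p2|apply: eB p1].
  + by apply: (uB p) => //; apply: eB p1.
- move=> [s [s0 cs]].
  have [[x xs Ax]|nA] := pselect (exists2 x, x \in s & A x).
    have sA : forall p, p \in s -> A p.
      apply: cycle_invariant cs _; last by exists x.
      by move=> p q /asboolP; apply: arcA.
    apply: acA; exists s; split=> //.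
    apply: (sub_in_cycle (P := mem s)) cs; last exact/allP.
    by move=> p q ps qs /asboolP h; apply/asboolP; apply: arcAA => //; apply: sA.
  have sB : forall p, p \in s -> B p.
    move=> p ps; have [q qs /asboolP] := cycle_arc cs ps.
    have Us : (A `|` B) p -> B p by case=> // Ap; case: nA; exists p.
    by case=> [[[/= _ h _ _] _]|[[/= h _ _ _] _]]; apply: Us.
  apply: acB; exists s; split=> //.
  apply: (sub_in_cycle (P := mem s)) cs; last exact/allP.
  by move=> p q ps qs /asboolP h; apply/asboolP; apply: arcBB => //; apply: sB.
- apply/seteqP; split=> // p [[Pp|Pp] nM].
  + suff : critical A MA p by rewrite cA.
    by split=> // -[e [m pe]]; apply: nM; exists e; split=> //; left.
  + suff : critical B MB p by rewrite cB.
    by split=> // -[e [m pe]]; apply: nM; exists e; split=> //; right.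
Qed.

(** The only arc runs upward from [v] to [u], so no arc leaves [u]. *)
Lemma perfect_acyclic_pair (u v : T) :
  (v < u)%O -> perfect_acyclic [set u; v] [set (u, v)].
Proof.
move=> vu; have nuv : u <> v by move=> E; move: vu; rewrite E ltxx.
have huv p q : hasse_edges [set u; v] (p, q) -> (p, q) = (u, v).
  case=> /= [[->|->]] [->|->] //; rewrite ?ltxx //.
  by move=> /lt_trans/(_ vu); rewrite ltxx.
split.
- split.
    move=> _ ->; split=> /=; [by right|by left|by []|].
    by move=> r [->|->] []; rewrite ltxx.
  by move=> p e1 e2 _ -> ->.
- move=> [s [s0 cs]]; case: s s0 cs => // x s _ cs.
  have arcE p q : matching_arc [set u; v] [set (u, v)] p q -> p = v /\ q = u.
    by case=> [[/huv h n]|[_ [-> ->]]//]; case: n.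
  have [q qs /asboolP/arcE[_ qu]] := cycle_arc cs (mem_head x s).
  have [r _ /asboolP/arcE[qv _]] := cycle_arc cs qs.
  by apply: nuv; rewrite -qu -qv.
- apply/seteqP; split=> // p [Pp []]; by exists (u, v).
Qed.

End PerfectMatchings.

(** * Minimisers and small step lengths *)

Lemma minimizer (T : Type) (Q : T -> Prop) (f : T -> nat) :
  (exists x, Q x) -> exists2 x, Q x & forall y, Q y -> (f x <= f y)%N.
Proof.
move=> [x Qx]; pose P n := `[< exists2 x, Q x & f x = n >].
have exP : exists n, P n by exists (f x); apply/asboolP; exists x.
case: (ex_minnP exP) => n /asboolP[z Qz fz] nmin; exists z => // t Qt.
by rewrite fz; apply: nmin; apply/asboolP; exists t.
Qed.

Lemma small_perturbation (R : realFieldType) (I : finType) (u v : I -> R) :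
  exists e : R, [/\ 0 < e, e <= 1 & forall i, u i < 0 -> u i + e * v i < 0].
Proof.
(* The summand 1 avoids division by zero and makes the final inequality strict. *)
pose h i := if u i < 0 then - u i / (1 + `|v i|) else 1.
have v0 i : 0 < 1 + `|v i| by rewrite ltr_wpDr.
have h0 i : 0 < h i.
  by rewrite /h; case: ifP => // ui; rewrite divr_gt0 // oppr_gt0.
pose e := \big[Num.min/1]_i h i.
have e0 : 0 < e by rewrite /e; elim/big_ind: _ => // x y; rewrite lt_min => -> ->.
have eh i : e <= h i by rewrite /e (bigminD1 i) // ge_min lexx.
exists e; split=> //; first exact: bigmin_le_id.
move=> i ui; have := eh i; rewrite /h ui ler_pdivlMr //.
have : e * v i <= e * `|v i| by rewrite ler_pM2l // ler_norm.
by nra.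
Qed.

(** * Faces and visibility for finite systems of affine inequalities *)

Section AffineInequalities.
Context (R : realFieldType) (V : lmodType R) (I : finType) (g : I -> V -> R).
Context (g_aff : forall i (x y : V) (t : R),
  g i (x + t *: (y - x)) = g i x + t * (g i y - g i x)).
Implicit Types (S : {set I}) (p q x y z : V).

Definition solutions : set V := [set x | forall i, g i x <= 0].

Definition active x : {set I} := [set i | g i x == 0]%SET.

(** For a solution [x], [pface (active x)] is the face with [x] in its relative interior; faces are
    represented by such points. *)
Definition pface S : set V := [set u | solutions u /\ forall i, i \in S -> g i u = 0].

(* The faces of [pface S] visible from [p], which is meant to lie in the affine
   span of [pface S]. *)
Definition vis S p : set (set V) :=
  [set F | exists x, [/\ solutions x, F = pface (active x), S \subset active x
                       & forall i, i \in active x -> i \notin S -> 0 < g i p]].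

Definition violated p : {set I} := [set i | 0 < g i p]%SET.

Lemma activeP i x : (i \in active x) = (g i x == 0).
Proof. by rewrite inE. Qed.

(** An inclusion can be tested at [x], which lies in its own face. *)
Lemma pface_sub x y : solutions x ->
  pface (active x) `<=` pface (active y) <-> active y \subset active x.
Proof.
move=> sx; split=> [h|/fintype.subsetP h u [su hu]]; last first.
  by split=> // i iy; apply: hu; apply: h.
have [] : pface (active y) x by apply: h; split=> // i; rewrite inE => /eqP.
by move=> _ hx; apply/fintype.subsetP => i iy; rewrite inE hx.
Qed.

Lemma pface_inj x y : solutions x -> solutions y ->
  pface (active x) = pface (active y) -> active x = active y.
Proof.
move=> sx sy E; apply/eqP; rewrite finset.eqEsubset; apply/andP.
by split; [apply/(pface_sub _ sy)|apply/(pface_sub _ sx)]; rewrite E.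
Qed.

Lemma solutions_lt x i : solutions x -> i \notin active x -> g i x < 0.
Proof. by move=> sx; rewrite inE lt_neqAle => -> /=. Qed.

Lemma stretch i x y t : g i (x + t *: (x - y)) = g i x - t * (g i y - g i x).
Proof. by rewrite -(opprB y x) scalerN -scaleNr g_aff mulNr. Qed.

(** Take [z] where the fewest [h j] vanish. If one of these were nonzero at some [x] of the affine
    span, a short move from [z] towards [x] would keep the active set and all nonzero values, and
    make this one nonzero too. *)
Lemma generic_point (J : finType) (h : J -> V -> R) S :
  (forall j x y t, h j (x + t *: (y - x)) = h j x + t * (h j y - h j x)) ->
  (exists2 z, solutions z & active z = S) ->
  exists z, [/\ solutions z, active z = S &
    forall j, h j z = 0 -> forall x, (forall i, i \in S -> g i x = 0) -> h j x = 0].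
Proof.
move=> h_aff [z0 sz0 az0].
have [|z [sz az] zmin] := @minimizer V (fun z => solutions z /\ active z = S)
  (fun z => #|[set j | h j z == 0]%SET|); first by exists z0.
exists z; split=> // j hz x xS; apply/eqP/negPn/negP => hx.
(* The entry for [j] is negative exactly when [h j z] is nonzero. After the move to [z'] it is
   [- h j z * h j z'], and its staying negative keeps [h j] nonzero. *)
have [e [e0 e1 he]] := small_perturbation
  (fun s : I + J => match s with inl i => g i z | inr j => - h j z ^+ 2 end)
  (fun s : I + J => match s with inl i => g i x - g i z
                               | inr j => - h j z * (h j x - h j z) end).
pose z' := z + e *: (x - z).
have gS i : i \in S -> g i z' = 0.
  move=> iS; have := iS; rewrite -az inE => /eqP gz.
  by rewrite g_aff gz (xS i iS) subrr mulr0 addr0.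
have gN i : i \notin S -> g i z' < 0.
  by move=> iS; rewrite g_aff; apply: (he (inl i)); apply: solutions_lt; rewrite ?az.
have := zmin z' _; rewrite leqNgt => /(_ _)/negP[].
  split=> [i|]; first by have [/gS->|/gN/ltW] := boolP (i \in S).
  apply/setP => i; rewrite inE; have [/gS->|/gN] := boolP (i \in S); first by rewrite eqxx.
  by rewrite lt_neqAle => /andP[/negbTE].
apply: proper_card; apply/properP; split.
  apply/fintype.subsetP => l; rewrite !inE => /eqP hl'; apply/negPn/negP => hl.
  have /(he (inr l)) : - h l z ^+ 2 < 0 by rewrite oppr_lt0 exprn_even_gt0.
  have -> : - h l z ^+ 2 + e * (- h l z * (h l x - h l z)) = - h l z * h l z'.
    by rewrite h_aff; ring.
  by rewrite hl' mulr0 ltxx.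
exists j; rewrite inE ?hz // h_aff hz subr0 add0r mulf_eq0 negb_or hx andbT.
by rewrite gt_eqF.
Qed.

(* [q] is the first crossing of a hyperplane on a generic segment from [p] to the
   relative interior of [pface S]; by the last item, due to genericity, the
   inequalities newly active at [q] all cut out the same hyperplane. *)
Lemma first_crossing S p :
  (exists2 z, solutions z & active z = S) ->
  (forall i, i \in S -> g i p = 0) -> violated p != finset.set0 ->
  exists q, [/\ S \proper active q,
    forall i, i \notin S -> g i q = 0 -> 0 < g i p,
    forall i, 0 < g i p -> 0 <= g i q,
    forall i, 0 < g i q -> 0 < g i p
  & forall i j x, i \in active q -> i \notin S -> j \in active q ->
      (forall l, l \in S -> g l x = 0) -> g i x = 0 -> g j x = 0].
Proof.
move=> zS pS /finset.set0Pn[i1]; rewrite inE => pi1.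
pose J := (I * I)%type.
(* For [i] and [j] positive at [p], [h (i, j) z = 0] says that the segment from [p] to [z] crosses
   both hyperplanes at the same point. *)
pose h (s : J) x := g s.1 p * g s.2 x - g s.2 p * g s.1 x.
have [|z [sz az gen]] := @generic_point J h S _ zS.
  by move=> s x y t; rewrite /h !g_aff; ring.
pose f i := g i z / g i p.
(* Hyperplane [i] is met at parameter [1 / (1 - f i)] with [f i] negative, so the smallest [f i]
   gives the first crossing. *)
have [i0 pi0 fmin] := @arg_minP _ R I i1 (fun i => 0 < g i p) f pi1.
have nS i : 0 < g i p -> i \notin S by move=> gi; apply/negP => /pS; lra.
have gz i : i \notin S -> g i z < 0 by move=> iS; apply: solutions_lt; rewrite ?az.
have gz0 := gz _ (nS _ pi0).
pose t := g i0 p / (g i0 p - g i0 z).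
have d0 : 0 < g i0 p - g i0 z by lra.
have t0 : 0 < t by rewrite divr_gt0.
have t1 : t < 1 by rewrite ltr_pdivrMr //; lra.
pose q := p + t *: (z - p).
have tE : t * (g i0 p - g i0 z) = g i0 p by rewrite divfK // gt_eqF.
have gq i : g i0 p * g i q = t * h (i0, i) z.
  rewrite /q g_aff /h /=.
  transitivity (g i0 p * t * g i z + (g i0 p - t * g i0 p) * g i p); first by ring.
  by rewrite -{2}tE; ring.
have hge i : 0 < g i p -> 0 <= h (i0, i) z.
  move=> gi; have := fmin i gi; rewrite /f ler_pdivrMr // mulrAC ler_pdivlMr //.
  by rewrite /h /=; lra.
have qge i : 0 < g i p -> 0 <= g i q.
  by move=> gi; rewrite -(pmulr_rge0 _ pi0) gq; apply: mulr_ge0; [exact: ltW|exact: hge].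
have qS i : i \in S -> g i q = 0.
  move=> iS; have := iS; rewrite -az inE => /eqP gzi.
  by rewrite g_aff gzi (pS i iS) subrr mulr0 addr0.
have qlt i : i \notin S -> ~~ (0 < g i p) -> g i q < 0.
  by move=> iS; rewrite -leNgt => gi; rewrite g_aff; have := gz i iS; nra.
have qi0 : g i0 q = 0.
  have := gq i0; rewrite /h /= subrr mulr0 => /eqP.
  by rewrite mulf_eq0 gt_eqF //= => /eqP.
have qp i : i \notin S -> g i q = 0 -> 0 < g i p.
  by move=> iS gi; apply/negPn/negP => /(qlt _ iS); rewrite gi ltxx.
exists q; split=> //.
- apply/properP; split; last by exists i0; rewrite ?nS // inE qi0.
  by apply/fintype.subsetP => i iS; rewrite inE qS.
- move=> i gi; apply/negPn/negP => ni; have [iS|iS] := boolP (i \in S).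
    by move: gi; rewrite qS // ltxx.
  by have := qlt i iS ni; lra.
- move=> i j x iq iS jq xS gix.
  have [/xS//|jS] := boolP (j \in S).
  (* Genericity extends the simultaneous crossing to the whole span of [pface S]. Then [g i x = 0]
     forces [g i0 x = 0], which in turn forces [g j x = 0]. *)
  have hx l : l \in active q -> h (i0, l) x = 0.
    rewrite inE => /eqP gl; apply: gen => //=.
    have := gq l; rewrite gl mulr0 => /esym/eqP.
    by rewrite mulf_eq0 gt_eqF //= => /eqP.
  have := hx i iq; have := hx j jq; rewrite /h /= gix mulr0 sub0r.
  move=> hj /eqP; rewrite oppr_eq0 mulf_eq0 gt_eqF /=; last first.
    by apply: qp => //; apply/eqP; rewrite -activeP.
  move=> /eqP g0x; move: hj; rewrite g0x mulr0 subr0 => /eqP.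
  by rewrite mulf_eq0 gt_eqF //= => /eqP.
Qed.

(* Pushing a point of a visible face away from [q] leaves only the inequalities
   active at [q] active. *)
Lemma vis_active_closed q F : vis (active q) q F ->
  exists2 z, solutions z & active z = active q.
Proof.
move=> [x [sx _ /fintype.subsetP qx vx]].
have [e [e0 e1 he]] := small_perturbation (g^~ x) (fun i => g i x - g i q).
pose z := x + e *: (x - q).
have gz i : g i z = g i x + e * (g i x - g i q) by rewrite stretch; ring.
have gS i : i \in active q -> g i z = 0.
  move=> iq; have := qx _ iq; rewrite inE gz => /eqP->.
  by move: iq; rewrite inE => /eqP->; rewrite subrr mulr0 addr0.
have gN i : i \notin active q -> g i z < 0.
  move=> iq; have [ix|ix] := boolP (i \in active x); last first.
    by rewrite gz; apply: he; exact: solutions_lt.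
  have gi := vx i ix iq; move: ix; rewrite inE gz => /eqP->.
  by nra.
exists z; first by move=> i; have [/gS->|/gN/ltW] := boolP (i \in active q).
apply/setP => i; rewrite inE; have [/gS->|/gN] := boolP (i \in active q).
  by rewrite eqxx.
by rewrite lt_neqAle => /andP[/negbTE].
Qed.

Lemma vis_perfect_acyclic S p :
  (exists2 z, solutions z & active z = S) ->
  (forall i, i \in S -> g i p = 0) -> violated p != finset.set0 ->
  exists M, perfect_acyclic (vis S p) M.
Proof.
have [n] := ubnP #|violated p|; elim: n => // n IH in S p *; rewrite ltnS => pn zS pS vp.
have [q [Sq qp pq0 qp0 hyp]] := first_crossing zS pS vp.
have [sSq [i0 i0q i0S]] := properP Sq.
have qn : (#|violated q| < n)%N.
  apply: leq_trans pn; apply: proper_card; apply/properP; split.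
    by apply/fintype.subsetP => i; rewrite !inE; apply: qp0.
  have gi0 : g i0 q = 0 by apply/eqP; rewrite -activeP.
  by exists i0; rewrite inE ?gi0 ?ltxx //; apply: qp.
have qS i : i \in S -> g i q = 0.
  by move=> iS; apply/eqP; rewrite -activeP; apply: (fintype.subsetP sSq).
(* If some index outside [S] is active at both [x] and [q], then by [hyp] all of [active q] is
   active at [x]. Otherwise the indices active at [x] outside [S] remain positive at [q]. *)
have visE : vis S p = vis (active q) q `|` vis S q.
  apply/seteqP; split=> F.
    move=> [x [sx -> Sx xp]].
    have xS l : l \in S -> g l x = 0.
      by move=> lS; apply/eqP; rewrite -activeP; apply: (fintype.subsetP Sx).
    have [[i [ix iS iq]]|no] :=
        pselect (exists i, [/\ i \in active x, i \notin S & i \in active q]).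
      left; exists x; split=> //.
        apply/fintype.subsetP => j jq; rewrite inE; apply/eqP.
        by apply: (hyp i) => //; apply/eqP; rewrite -activeP.
      move=> j jx jq; have jS : j \notin S by apply: contra jq; apply: (fintype.subsetP sSq).
      by rewrite lt_neqAle pq0 ?xp // andbT eq_sym -activeP.
    right; exists x; split=> // j jx jS; rewrite lt_neqAle pq0 ?xp // andbT eq_sym.
    by rewrite -activeP; apply/negP => jq; apply: no; exists j.
  move=> [|] [x [sx -> xS xq]]; exists x; split=> //.
  - exact: fintype.subset_trans xS.
  - move=> i ix iS; have [iq|iq] := boolP (i \in active q).
      by apply: qp => //; apply/eqP; rewrite -activeP.
    by apply: qp0; apply: xq.
  - by move=> i ix iS; apply: qp0; apply: xq.
(* A face of the first part has [i0] among its active indices; a face of the second part cannot,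
   since [g i0 q = 0]. *)
have low F G : vis (active q) q F -> vis S q G -> ~ (G <= F)%O.
  move=> [x [sx -> /fintype.subsetP qx _]] [y [sy -> _ yq]].
  move=> /subsetPset/(pface_sub _ sy)/fintype.subsetP xy.
  have := yq i0 (xy _ (qx _ i0q)) i0S.
  by move: i0q; rewrite inE => /eqP->; rewrite ltxx.
(* If [q] violates nothing, it is a solution, and with no inequality positive there each part is a
   single face. *)
have [q0|q0] := eqVneq (violated q) finset.set0.
  have sq : solutions q.
    by move=> i; rewrite leNgt; apply/negP => gi; have := finset.in_set0 i; rewrite -q0 inE gi.
  have [z sz az] := zS.
  have nq i : ~ 0 < g i q by move=> gi; have := sq i; lra.
  have lone T w : solutions w -> active w = T -> vis T q = [set pface T].
    move=> sw aw; apply/seteqP; split=> [F [x [sx -> Tx xq]]|_ ->]; last first.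
      by exists w; split; rewrite ?aw // => i ->.
    congr pface; apply/eqP; rewrite finset.eqEsubset Tx andbT; apply/fintype.subsetP => i ix.
    by apply/negPn/negP => /(xq _ ix)/nq.
  exists [set (pface S, pface (active q))].
  rewrite visE (lone _ q) // (lone _ z) // setUC; apply: perfect_acyclic_pair.
  rewrite lt_neqAle; apply/andP; split.
    by apply/eqP; rewrite -az => /(pface_inj sq sz) E; move: Sq; rewrite E az fintype.properxx.
  by apply/subsetPset; rewrite -az; apply/pface_sub => //; rewrite az.
have [MB pB] := IH S q qn zS qS q0.
(* The first part may be empty. When it is not, [vis_active_closed] supplies the solution needed by
   the induction hypothesis. *)
have [[F vF]|no] := pselect (exists F, vis (active q) q F); last first.
  exists MB; rewrite visE; have -> : vis (active q) q = set0; last by rewrite set0U.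
  by apply/seteqP; split=> // F vF; apply: no; exists F.
have [|MA pA] := IH (active q) q qn (vis_active_closed vF) _ q0.
  by move=> i; rewrite inE => /eqP.
by exists (MA `|` MB); rewrite visE; apply: perfect_acyclicU.
Qed.

(** Choose [x] with the fewest active inequalities. At the midpoint of [x] and [u] only those active
    at both ends are active, and by minimality these are still all of [active x]. *)
Lemma common_active (Q : set V) : Q !=set0 -> Q `<=` solutions ->
  (forall x y, Q x -> Q y -> Q (x + 2^-1 *: (y - x))) ->
  exists2 x, Q x & forall u, Q u -> active x \subset active u.
Proof.
move=> Q0 Qs Qm; have [x Qx xmin] := minimizer (fun x => #|active x|) Q0.
exists x => // u Qu; pose w := x + 2^-1 *: (u - x).
have sw : active w \subset active x :&: active u.
  apply/fintype.subsetP => i; rewrite !inE g_aff => /eqP gw.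
  by have := Qs _ Qx i; have := Qs _ Qu i; lra.
have /eqP E : active w == active x.
  rewrite eqEcard xmin ?andbT; last exact: Qm.
  exact: fintype.subset_trans sw (subsetIl _ _).
by rewrite -E; apply: fintype.subset_trans sw (subsetIr _ _).
Qed.

End AffineInequalities.

(** * Dot products, affine hulls, dimension and irredundancy *)

Section Polytopes.
Context (R : realType) (k : nat).
Local Notation V := 'rV[R]_k.
Implicit Types (u v x y z : V) (X F G A : set V).

Lemma dotvC u v : dotv u v = dotv v u.
Proof. by apply: eq_bigr => i _; rewrite mulrC. Qed.

Lemma dotvDr u x y : dotv u (x + y) = dotv u x + dotv u y.
Proof. by rewrite /dotv -big_split; apply: eq_bigr => i _; rewrite mxE mulrDr. Qed.

Lemma dotvZr u t x : dotv u (t *: x) = t * dotv u x.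
Proof. by rewrite /dotv mulr_sumr; apply: eq_bigr => i _; rewrite mxE mulrCA. Qed.

Lemma dotvBr u x y : dotv u (x - y) = dotv u x - dotv u y.
Proof. by rewrite -scaleN1r dotvDr dotvZr mulN1r. Qed.

Lemma dotv_sumr (I : finType) (P : pred I) u (f : I -> V) :
  dotv u (\sum_(i | P i) f i) = \sum_(i | P i) dotv u (f i).
Proof.
rewrite /dotv exchange_big; apply: eq_bigr => j _.
by rewrite summxE mulr_sumr.
Qed.

Lemma dotv_self_gt0 u : u != 0 -> 0 < dotv u u.
Proof.
move=> u0; rewrite lt_neqAle sumr_ge0 => [|i _]; last by rewrite -expr2 sqr_ge0.
rewrite andbT eq_sym; apply: contra u0 => /eqP E; apply/eqP/matrixP => i j.
rewrite (ord1 i) mxE; apply/eqP; rewrite -sqrf_eq0 expr2.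
apply/eqP; apply: (psumr_eq0P _ E) => // l _.
by rewrite -expr2 sqr_ge0.
Qed.

Lemma dotv_affine_hull A u (c : R) v :
  (forall x, A x -> dotv u x = c) -> affine_hull A v -> dotv u v = c.
Proof.
move=> Au [n [p [w [Ap w1 ->]]]]; rewrite dotv_sumr.
rewrite (eq_bigr (fun i => w i * c)) => [|i _]; last by rewrite dotvZr Au.
by rewrite -mulr_suml w1 mul1r.
Qed.

Lemma affine_hull_line A x z (t : R) :
  A x -> A z -> affine_hull A (x + t *: (z - x)).
Proof.
move=> Ax Az; exists 2%N, (fun i => if val i == 0%N then x else z),
  (fun i => if val i == 0%N then 1 - t else t); split.
- by move=> i; case: ifP.
- by rewrite !big_ord_recl big_ord0 /= addr0 subrK.
- rewrite !big_ord_recl big_ord0 /= addr0 scalerBr scalerBl scale1r.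
  by rewrite addrCA addrC.
Qed.

(** The direction space is recovered as the set of differences of points of the affine hull,
    whatever the base point. *)
Lemma has_dim_inj A n m : has_dim A n -> has_dim A m -> n = m.
Proof.
move=> [x [U [AU <-]]] [y [W [AW <-]]]; congr (\dim _); apply/vspaceP => v.
have xW : y + 0 \in affine_hull A by rewrite AW inE; exists 0 => //=; rewrite mem0v.
have xU : x + 0 \in affine_hull A by rewrite AU inE; exists 0 => //=; rewrite mem0v.
have key (x' : V) (U' : {vspace V}) z w : affine_hull A = [set x' + u | u in [set` U']] ->
   affine_hull A z -> affine_hull A w -> w - z \in U'.
  by move=> -> [u1 /= u1U <-] [u2 /= u2U <-]; rewrite opprD addrACA subrr add0r rpredB.
rewrite !inE !addr0 in xW xU.
apply/idP/idP => vU.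
  have : affine_hull A (x + v) by rewrite AU; exists v.
  by move=> /(key _ _ _ _ AW xU); rewrite addrAC subrr add0r.
have : affine_hull A (y + v) by rewrite AW; exists v.
by move=> /(key _ _ _ _ AU xW); rewrite addrAC subrr add0r.
Qed.

(** Take a representation with the fewest inequalities: one implied by the others could be
    dropped. *)
Lemma irredundant_representation X : polytope X ->
  exists (m : nat) (a : 'I_m -> V) (b : 'I_m -> R),
    [/\ forall i, a i != 0, X = solutions (fun i x => dotv (a i) x - b i)
      & forall i, exists2 z, 0 < dotv (a i) z - b i
          & forall j, j != i -> dotv (a j) z - b j <= 0].
Proof.
move=> [_ [m0 [a0 [b0 [a00 X0]]]]].
pose T := {m : nat & (('I_m -> V) * ('I_m -> R))%type}.
pose Q (r : T) := (forall i, (projT2 r).1 i != 0) /\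
   X = solutions (fun i x => dotv ((projT2 r).1 i) x - (projT2 r).2 i).
have [|[m [a b]] [/= an0 XE] rmin] := @minimizer T Q (@projT1 _ _).
  exists (existT _ m0 (a0, b0)); split=> //=; rewrite X0.
  apply/seteqP; split=> x h i; first by rewrite subr_le0; apply: h.
  by move=> _; have := h i; rewrite subr_le0.
exists m, a, b; split=> // i; apply: contrapT => nz.
case: m a b an0 XE rmin i nz => [|m] a b an0 XE rmin i nz; first by case: i nz.
suff : (m.+1 <= m)%N by rewrite ltnn.
apply: (rmin (existT _ m (a \o lift i, b \o lift i))).
split=> [j|]; rewrite /=; first exact: an0.
rewrite XE; apply/seteqP; split=> x h j; first exact: h.
have [j' ->|->] := unliftP i j; first exact: h.
rewrite leNgt; apply/negP => gi; apply: nz; exists x => // l li.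
by have [l' ->|E] := unliftP i l; [exact: h|rewrite E eqxx in li].
Qed.

(** * Faces and interior of a polytope given by inequalities *)

Section Representation.
Context (m : nat) (a : 'I_m -> V) (b : 'I_m -> R).
Let g i x := dotv (a i) x - b i.
Local Notation X := (solutions g).
Context (a_neq0 : forall i, a i != 0).

Lemma slack_affine i x y (t : R) : g i (x + t *: (y - x)) = g i x + t * (g i y - g i x).
Proof. by rewrite /g dotvDr dotvZr dotvBr; ring. Qed.
Let g_aff := slack_affine.

(** [common_active] gives [x] in [F]. For [u] in [pface g (active g x)], the segment from [u] to [x]
    can be prolonged beyond [x] inside [X]; a form maximal at [x] is then constant along it, so [u]
    is in [F]. *)
Lemma face_pface F : face X F -> F !=set0 ->
  exists2 x, X x & F = pface g (active g x).
Proof.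
move=> [c [d [Xc FE]]] F0.
have FX : F `<=` X by rewrite FE => x [].
have [|x Fx xF] := common_active g_aff F0 FX.
  rewrite FE => x y [Xx /= cx] [Xy /= cy]; split=> /=.
    by move=> i; rewrite g_aff; have := Xx i; have := Xy i; lra.
  by rewrite dotvDr dotvZr dotvBr cx cy subrr mulr0 addr0.
exists x; first exact: FX.
apply/seteqP; split=> u.
  move=> Fu; split; first exact: FX.
  by move=> i /(fintype.subsetP (xF u Fu)); rewrite inE => /eqP.
move=> [Xu ux]; rewrite FE; split=> //=.
have [e [e0 e1 he]] := small_perturbation (g^~ x) (fun i => g i x - g i u).
have Xw : X (x + e *: (x - u)).
  move=> i; rewrite (stretch g_aff).
  have [ix|ix] := boolP (i \in active g x).
    by rewrite (ux i ix); move: ix; rewrite inE => /eqP->; rewrite subrr mulr0 subr0.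
  by have := he i (solutions_lt (FX _ Fx) ix); lra.
have := Xc _ Xw; have := Xc _ Xu; move: Fx; rewrite FE /halfspace /= => -[_ /= cx].
by rewrite dotvDr dotvZr dotvBr cx; nra.
Qed.

(** The sum of the inequalities in [S] is a supporting form: a sum of nonpositive terms vanishes
    only if each term does. *)
Lemma pface_face (S : {set 'I_m}) : face X (pface g S).
Proof.
pose c := \sum_(i in S) a i; pose d := \sum_(i in S) b i.
have cdE x : dotv c x - d = \sum_(i in S) g i x.
  by rewrite dotvC dotv_sumr -sumrB; apply: eq_bigr => i _; rewrite dotvC.
exists c, d; split=> [x Xx|].
  by rewrite /halfspace /= -subr_le0 cdE; apply: sumr_le0 => i _; apply: Xx.
apply/seteqP; split=> x [Xx]; move=> Sx; split=> //=.
  by apply/eqP; rewrite -subr_eq0 cdE big1.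
move=> i iS; apply/eqP; rewrite -oppr_eq0; apply/eqP.
apply: (psumr_eq0P (P := mem S) (F := fun i => - g i x)) => //.
  by move=> j _; rewrite oppr_ge0.
by rewrite sumrN -cdE Sx subrr oppr0.
Qed.

Lemma slack_ball i x u (e : R) : ball x e u ->
  g i u <= g i x + e * \sum_j `|a i 0 j|.
Proof.
move=> xu; rewrite -lerBlDl /g opprB addrA subrK -dotvBr mulr_sumr.
apply: ler_sum => j _; apply: le_trans (ler_norm _) _.
rewrite normrM mulrC ler_wpM2r // !mxE distrC.
by case: xu => _ /(_ 0 j)/ltW.
Qed.

Lemma interior_solutions x : X° x <-> forall i, g i x < 0.
Proof.
split=> [|h].
  move=> /nbhs_ballP[e /= e0 eX] i.
  (* [s] exceeds every coordinate of [a i] in absolute value, so the step [e / s] along [a i] stays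
     in the ball, while it strictly increases [g i]. *)
  pose s := 1 + \sum_j `|a i 0 j|.
  have s0 : 0 < s by rewrite ltr_wpDr // sumr_ge0.
  pose t := e / s.
  have t0 : 0 < t by rewrite divr_gt0.
  have /eX/(_ i) : ball x e (x + t *: a i).
    split=> // j l; rewrite (ord1 j) /ball /= !mxE opprD addNKr normrN normrM gtr0_norm //.
    have -> : e = t * s by rewrite divfK // gt_eqF.
    rewrite ltr_pM2l // /s (bigD1 l) //= addrCA ltrDl ltr_wpDr //.
    exact: sumr_ge0.
  by rewrite /g dotvDr dotvZr; have := dotv_self_gt0 (a_neq0 i); nra.
have [e [e0 e1 he]] := small_perturbation (g^~ x) (fun i => \sum_j `|a i 0 j|).
apply/nbhs_ballP; exists e => //= u xu i.
exact: le_trans (slack_ball i xu) (ltW (he i (h i))).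
Qed.

(** An inequality active at a point with the fewest active ones is active on all of [X], hence on
    its affine hull, here the whole space; this contradicts [a i != 0]. *)
Lemma interior_point : has_dim X k -> exists x, forall i, g i x < 0.
Proof.
move=> [x0 [U [hullE dimU]]].
have hullT v : affine_hull X v.
  rewrite hullE; exists (v - x0); last by rewrite addrC subrK.
  suff -> : U = fullv by rewrite /= memvf.
  by apply/eqP; rewrite eqEdim subvf dimvf dimU dim_matrix mul1r leqnn.
have X0 : X !=set0.
  have [n [p [c [Xp c1 _]]]] := hullT 0; case: n p c Xp c1 => [|n] p c Xp c1.
    by move: c1; rewrite big_ord0 => /esym/eqP; rewrite oner_eq0.
  by exists (p ord0); exact: Xp.
have [//||x Xx xX] := common_active g_aff X0.
  move=> x y Xx Xy i; rewrite g_aff; have := Xx i; have := Xy i; lra.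
exists x => i; apply: (solutions_lt Xx); apply/negP => ix.
have ai v : dotv (a i) v = b i.
  apply: dotv_affine_hull (hullT v) => u Xu.
  by have := fintype.subsetP (xX u Xu) i ix; rewrite inE subr_eq0 => /eqP.
(* The constant form would take the same value at [a i], where it is positive, and at its double. *)
by have := dotv_self_gt0 (a_neq0 i); have := ai (a i + a i); rewrite dotvDr ai; lra.
Qed.

(** * Facets and visible faces for an irredundant representation *)

Section Irredundant.
Context (irr : forall i, exists2 z, 0 < g i z & forall j, j != i -> g j z <= 0).
Context (dimX : has_dim X k).

(** The segment from an interior point to a point violating only inequality [i] crosses hyperplane
    [i] while the others are still strict. *)
Lemma facet_point i : exists w, g i w = 0 /\ forall j, j != i -> g j w < 0.
Proof.
have [x hx] := interior_point dimX; have [z zi zj] := irr i.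
pose t := g i x / (g i x - g i z).
have d0 : g i x - g i z < 0 by have := hx i; lra.
have t0 : 0 < t by rewrite ltr_ndivlMr // mul0r.
have t1 : t < 1 by rewrite ltr_ndivrMr //; lra.
have tE : t * (g i x - g i z) = g i x by rewrite divfK // lt_eqF.
exists (x + t *: (z - x)); split; first by rewrite g_aff; lra.
by move=> j ji; rewrite g_aff; have := hx j; have := zj j ji; nra.
Qed.

(** Any [v] of the hyperplane is on the line through [w] and a nearby facet point
    [w + e *: (v - w)]. *)
Lemma affine_hull_facet i : affine_hull (pface g [set i]) = [set v | g i v = 0].
Proof.
have [w [wi wj]] := facet_point i.
have pw : pface g [set i] w.
  split=> [j|j /set1P->//]; have [->|/wj/ltW//] := eqVneq j i.
  by rewrite wi.
apply/seteqP; split=> v /=.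
  move=> /(dotv_affine_hull (u := a i) (c := b i)) h; apply/eqP; rewrite subr_eq0.
  apply/eqP/h => x [_ /(_ i)]; rewrite set11 => /(_ isT)/eqP.
  by rewrite subr_eq0 => /eqP.
move=> vi; have [e [e0 e1 he]] := small_perturbation (g^~ w) (fun j => g j v - g j w).
have pz : pface g [set i] (w + e *: (v - w)).
  have zi : g i (w + e *: (v - w)) = 0 by rewrite g_aff vi wi subrr mulr0 addr0.
  split=> [j|j /set1P->//]; have [->|/wj/he/ltW] := eqVneq j i; first by rewrite zi.
  by rewrite g_aff.
have := affine_hull_line e^-1 pw pz.
by rewrite [_ + _ *: _ - _]addrAC subrr add0r scalerA mulVf ?gt_eqF // scale1r addrC subrK.
Qed.

(** The direction space is the kernel of a nonzero linear form, of dimension [k - 1] by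
    rank-nullity. *)
Lemma facet_pface i : facet X (pface g [set i]).
Proof.
split; first exact: pface_face.
pose f : V -> R^o := dotv (a i).
have flin : linear f by move=> t x y; rewrite /f dotvDr dotvZr.
pose fL : {linear V -> R^o} := HB.pack f (GRing.isLinear.Build _ _ _ _ f flin).
pose L := linfun fL.
have LE v : L v = dotv (a i) v by rewrite lfunE.
have [w [wi wj]] := facet_point i.
have dimL : (\dim (lker L)).+1 = k.
  have := limg_ker_dim L fullv; rewrite capfv dimvf dim_matrix mul1r.
  suff -> : \dim (limg L) = 1%N by rewrite addn1.
  apply/eqP; rewrite eqn_leq; apply/andP; split.
    by rewrite (leq_trans (dimvS (subvf _))) // dimvf.
  rewrite lt0n dimv_eq0; apply/eqP => L0.
  have : L (a i) \in limg L by rewrite memv_img ?memvf.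
  by rewrite L0 memv0 LE gt_eqF // dotv_self_gt0.
exists (\dim (lker L)); split; last by rewrite dimL.
exists w, (lker L); split=> //; rewrite affine_hull_facet.
apply/seteqP; split=> v /=.
  move=> vi; exists (v - w); last by rewrite addrC subrK.
  by rewrite /= memv_ker LE dotvBr; apply/eqP; move: vi wi; rewrite /g; lra.
move=> [u /=]; rewrite memv_ker LE => /eqP ui <-.
by move: wi; rewrite /g dotvDr ui addr0.
Qed.

(** Visibility becomes a sign condition. If [g i y] is negative, a short step from the point [w] of
    facet [i] towards [y] enters the interior; if it is positive, [g i] is nonnegative on every
    segment from [y] to that facet. *)
Lemma visible_faces_vis y :
  (forall G, facet X G -> ~ affine_hull G y) ->
  visible_faces X y = vis g finset.set0 y.
Proof.
move=> yG; apply/seteqP; split=> F.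
  move=> [/face_pface Ff F0 visF]; have [x Xx FE] := Ff F0.
  exists x; split=> // [|i ix _]; first exact: finset.sub0set.
  have [w [wi wj]] := facet_point i.
  have [_ vG] : visible_facet X y (pface g [set i]).
    apply: visF; first exact: facet_pface.
    by rewrite FE => u [Xu ux]; split=> // j /set1P->; apply: ux.
  have pw : pface g [set i] w.
    split=> [j|j /set1P->//]; have [->|/wj/ltW//] := eqVneq j i.
    by rewrite wi.
  have yi0 : g i y != 0.
    by apply/eqP => yi; apply: (yG _ (facet_pface i)); rewrite affine_hull_facet.
  rewrite lt_neqAle eq_sym yi0 /= leNgt; apply/negP => yi.
  have [e [e0 e1 he]] := small_perturbation (g^~ w) (fun j => g j y - g j w).
  have : (segment y w `&` X°) (w + e *: (y - w)).
    split; last first.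
      apply/interior_solutions => j; have [->|/wj/he] := eqVneq j i.
        by rewrite g_aff wi add0r subr0; nra.
      by rewrite g_aff.
    (* [segment y w] puts the weight [t] on [w], hence [1 - e]. *)
    exists (1 - e); first by rewrite /= in_itv /=; apply/andP; split; lra.
    by rewrite subKr scalerBr scalerBl scale1r addrCA.
  by rewrite vG.
move=> [x [Xx -> _ xy]]; split; first exact: pface_face.
  by exists x; split=> // i; rewrite inE => /eqP.
move=> G fG FG; split=> // z Gz.
have [fcG [n [dG dX]]] := fG.
have [|x' Xx' GE] := face_pface fcG; first by exists z.
(* Without an active inequality [G] would be [X], of the wrong dimension. One index [i] active on
   [G] suffices to separate [y] from the interior. *)
have /set0Pn[i ix'] : active g x' != finset.set0.
  apply/eqP => x'0; have GX : G = X.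
    by rewrite GE x'0; apply/seteqP; split=> [u []//|u Xu]; split=> // j; rewrite inE.
  by rewrite GX in dG; have /eqP := has_dim_inj dG dX; rewrite ltn_eqF.
have ix : i \in active g x.
  by move: FG; rewrite GE => /(pface_sub _ Xx)/fintype.subsetP; apply.
have yi := xy i ix; rewrite finset.in_set0 in yi.
have zi : g i z = 0 by move: Gz; rewrite GE => -[_]; apply.
apply/seteqP; split=> // _ [[t /= t01 <-] /interior_solutions/(_ i)].
move: t01; rewrite in_itv /= => /andP[t0 t1].
rewrite /g dotvDr !dotvZr; move: zi (yi isT); rewrite /g; nra.
Qed.

End Irredundant.
End Representation.
End Polytopes.

Theorem theorem4p9 (R : realType) (k : nat) (X : set 'rV[R]_k) (y : 'rV[R]_k) :
  polytope X ->
  has_dim X k ->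
  ~ X y ->
  (forall G, facet X G -> ~ affine_hull G y) ->
  exists M : set (set 'rV[R]_k * set 'rV[R]_k),
    [/\ is_matching (visible_faces X y) M,
        acyclic (visible_faces X y) M
      & critical (visible_faces X y) M = set0].
Proof.
move=> /irredundant_representation[m [a [b [a0 -> irr]]]] dimX yX yG.
rewrite (visible_faces_vis a0 irr dimX yG).
have [x hx] := interior_point a0 dimX.
(* The argument starts from the face [X] itself, with no active inequality: an interior point
   represents it, and [y] violates something because it is outside [X]. *)
apply: (vis_perfect_acyclic (slack_affine a b)).
- exists x; first by move=> i; exact: ltW.
  by apply/setP => i; rewrite !inE lt_eqF.
- by move=> i; rewrite inE.
- apply/eqP => v0; apply: yX => i; rewrite leNgt; apply/negP => yi.
  by have := finset.in_set0 i; rewrite -v0 inE yi.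
Qed.
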